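(* Let $F$ be a finite field with $|F|=q$, and let $V$ be a vector space over $F$ with $\dim(V)=n$. If $n$ is even, then $$\sum_{i=1}^{\frac{n}{2}-1} \begin{bmatrix} n \\ i \end{bmatrix}_{q}+\begin{bmatrix} n-1 \\ \frac{n-2}{2} \end{bmatrix}_{q}\;\leq\; \chi(G(V))\;\leq\; \sum_{i=1}^{\frac{n}{2}-1} \begin{bmatrix} n \\ i \end{bmatrix}_{q}+\begin{bmatrix} n \\ \frac{n}{2} \end{bmatrix}_{q}-q^{\frac{n^2}{4}}-1.$$
   Context: For a finite-dimensional vector space $V$ over a finite field, the intersection graph of subspaces $G(V)$ is the simple graph whose vertices are the proper nontrivial subspaces of $V$ (i.e. subspaces $W$ with $W\neq 0$ and $W\neq V$), two distinct vertices being adjacent if and only if the corresponding subspaces have nonzero intersection. A proper vertex coloring of a graph $G$ is a function $f$ on the vertex set with $f(u)\neq f(v)$ for any adjacent vertices $u,v$; the chromatic number $\chi(G)$ is the minimum $k$ such that there is a proper vertex coloring $f$ of $G$ whose image has exactly $k$ elements. For an integer $m\geq 1$ and $t\in\{1,\dots,m\}$, $\begin{bmatrix} m \\ t \end{bmatrix}_{q}=\prod_{0\leq i<t}\frac{q^{m-i}-1}{q^{t-i}-1}$ is the number of $t$-dimensional subspaces of an $m$-dimensional vector space over the field with $q$ elements; also $\begin{bmatrix} m \\ 0 \end{bmatrix}_{q}=1$ and $\begin{bmatrix} m \\ t \end{bmatrix}_{q}=0$ if $t\notin\{0,1,\dots,m\}$.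
   Formalization: The upper bound is stated only for even n > 2, since for n = 2 the graph has q+1 vertices and no edges, so χ = 1 while the right-hand side is 0; n = 0 is also excluded, where the lower bound is undefined and the upper bound is −1 < χ = 0. *)

(* Defs.v *)
From HB Require Import structures.
From mathcomp Require Import all_boot all_order all_algebra.

Set Implicit Arguments.
Unset Strict Implicit.
Unset Printing Implicit Defensive.

Import GRing.Theory.

Section Coloring.

Variables (T : finType) (e : rel T).

Definition proper_coloring (C : eqType) (f : T -> C) : bool :=
  [forall u, forall v, e u v ==> (f u != f v)].

(* Colours are taken in 'I_#|T| only to make this decidable; lemma
   chromatic_number_le below shows that the choice of the set of colours
   does not affect the chromatic number. *)
Definition has_k_coloring (k : nat) : bool :=
  [exists f : {ffun T -> 'I_#|T|},
     proper_coloring f && (#|[set f x | x : T]| == k)].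

Hypothesis e_irr : irreflexive e.

Lemma ex_k_coloring : exists k, has_k_coloring k.
Proof.
pose f := [ffun x : T => enum_rank x].
exists #|[set f x | x : T]|; apply/existsP; exists f; rewrite eqxx andbT.
apply/forallP=> u; apply/forallP=> v; apply/implyP=> euv.
rewrite !ffunE (inj_eq enum_rank_inj).
by apply: contraTneq euv => ->; rewrite e_irr.
Qed.

Definition chromatic_number : nat := ex_minn ex_k_coloring.

Lemma chromatic_number_le (C : eqType) (f : T -> C) :
  proper_coloring f -> chromatic_number <= size (undup (codom f)).
Proof.
move=> fP; rewrite /chromatic_number; case: ex_minnP => k _; apply.
have ltf x : index (f x) (codom f) < #|T|.
  by rewrite -(size_codom f) index_mem codom_f.
pose g := [ffun x => Ordinal (ltf x)].
have gE x y : (g x == g y) = (f x == f y).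
  rewrite !ffunE -val_eqE /=; apply/eqP/eqP=> [eqi|-> //].
  by rewrite -(nth_index (f x) (codom_f f x)) eqi nth_index ?codom_f.
apply/existsP; exists g; apply/andP; split.
  apply/forallP=> u; apply/forallP=> v; rewrite gE.
  by have /forallP/(_ u)/forallP/(_ v) := fP.
pose h (i : 'I_#|T|) := nth None (map some (codom f)) i.
have hg x : h (g x) = Some (f x).
  rewrite /h ffunE /= (nth_map (f x)) ?nth_index ?codom_f //.
  by rewrite size_codom.
apply/eqP; rewrite cardE -(size_map h) -[RHS](size_map some).
apply/perm_size/uniq_perm.
- rewrite map_inj_in_uniq ?enum_uniq // => i j.
  rewrite !mem_enum => /imsetP[x _ ->] /imsetP[y _ ->].
  by rewrite !hg => -[/eqP]; rewrite -gE => /eqP.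
- by rewrite map_inj_uniq ?undup_uniq // => x y [].
move=> z; apply/mapP/mapP=> [[i]|[c]].
  rewrite mem_enum => /imsetP[x _ ->] ->; exists (f x); rewrite ?hg //.
  by rewrite mem_undup codom_f.
rewrite mem_undup => /codomP[x ->] ->; exists (g x); rewrite ?hg //.
by rewrite mem_enum imset_f.
Qed.

End Coloring.

Import VectorInternalTheory.

Section SubspaceGraph.

Variables (F : finFieldType) (V : vectType F).

HB.instance Definition _ := [Countable of {vspace V} by <:].
HB.instance Definition _ := [Finite of {vspace V} by <:].

Definition subspace_vertex : finType :=
  {W : {vspace V} | (W != 0%VS) && (W != fullv)}.

Definition subspace_adj : rel subspace_vertex :=
  fun U W => (U != W) && ((val U :&: val W)%VS != 0%VS).

Lemma subspace_adj_irr : irreflexive subspace_adj.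
Proof. by move=> U; rewrite /subspace_adj eqxx. Qed.

Lemma subspace_adj_sym : symmetric subspace_adj.
Proof. by move=> U W; rewrite /subspace_adj eq_sym capvC. Qed.

Definition chi_subspace_graph : nat := chromatic_number subspace_adj_irr.

End SubspaceGraph.

Definition gauss_binom (q m t : nat) : rat :=
  (if (t <= m)%N then
     \prod_(i < t) ((q%:R ^+ (m - i) - 1) / (q%:R ^+ (t - i) - 1))
   else 0)%R.

(* Main.v *)
Require Import Defs.
From HB Require Import structures.
From mathcomp Require Import all_boot all_order all_algebra.
From mathcomp Require Import finfield zify.

(** Write n = 2m and let q be the order of the field.

    Lower bound.  Two subspaces meet nontrivially as soon as the sum of their
    dimensions exceeds the dimension of a subspace that contains both
    ([capv_neq0_dim]).  So the proper subspaces of dimension greater than m,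
    together with the subspaces of dimension m inside a fixed hyperplane, form
    a clique, and a clique needs as many colours as it has elements.

    Upper bound.  A colour class is a set of subspaces that pairwise meet in 0.
    The relation of being complementary is regular on the pairs of
    complementary dimensions i and n - i: every subspace of either dimension
    has q^(i(n-i)) complements ([card_complements]).  By Hall's theorem there
    is then an injection that sends each subspace to one of its complements
    ([complement_bijection]), so a subspace of dimension greater than m can
    share the colour of its partner of dimension less than m, and these
    dimensions cost one colour for each subspace of dimension between 1
    and m - 1.

    The subspaces of dimension m get colours of their own.  The subgraph on
    them is regular of degree [n, m] - q^(m^2) - 1, and the bound claims that
    this many colours suffice, which is Brooks' theorem.  In this graph any two
    vertices are at distance at most 2, and Lovasz's greedy proof becomes
    short ([radius_two_brooks], [middle_colouring]): give two nonadjacent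
    neighbours u and v of a vertex w the same colour, then colour greedily the
    vertices not adjacent to w, then the neighbours of w, and finally w.
    Every vertex other than u and v that comes before w has an uncoloured
    neighbour when its turn comes, and w sees a colour twice; so a colour is
    always free.  This uses m > 1: for m = 1 the degree is 0, and no such
    u, v, w exist.

    All counts come from one formula, for the number of t-dimensional
    subspaces of U that meet a given subspace A of U in 0
    ([card_disjoint_subspaces]): A = 0 gives the Gaussian binomials and U = V
    the numbers of complements. *)

Set Implicit Arguments.
Unset Strict Implicit.
Unset Printing Implicit Defensive.

Import Order.TTheory GRing.Theory Num.Theory.

(** * Matchings *)

Section Matching.

(** Rado's proof.  If some [N a] has two elements x and y, then one of them can
    be deleted from [N a] without violating the hypothesis, so by induction
    all the sets may be taken to be singletons, which the hypothesis makes
    distinct.  If both deletions failed, with violators P and Q, then P and Q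
    would contain a, and submodularity of the size of the union would
    contradict the hypothesis for the union of P and Q or for their
    intersection without a. *)
Lemma hall_marriage (A B : finType) (N : A -> {set B}) :
    (forall S : {set A}, #|S| <= #|\bigcup_(a in S) N a|) ->
  exists g : A -> B, injective g /\ forall a, g a \in N a.
Proof.
have [s] := ubnP (\sum_a #|N a|); elim: s N => // s IHs N lt_s hallN.
have [/forallP N1 | ] := boolP [forall a, #|N a| <= 1].
  have NE a : {b | N a == [set b]}.
    apply: sigW; have /cards1P[b ->] : #|N a| == 1; last by exists b.
    by rewrite eqn_leq N1; have := hallN [set a]; rewrite big_set1 cards1.
  exists (fun a => sval (NE a)); split=> [a b|a]; last first.
    by case: (NE a) => /= x /eqP->; rewrite inE.
  case: (NE a) (NE b) => /= x /eqP Na [/= y /eqP Nb] xy.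
  apply/eqP/contraT => neq_ab; have := hallN [set a; b].
  by rewrite cards2 neq_ab bigcup_setU !big_set1 Na Nb xy setUid cards1.
case/forallPn=> a; rewrite -ltnNge => /card_gt1P[x [y [Nx Ny neq_xy]]].
pose M z b := if b == a then N a :\ z else N b.
have sub_M z b : M z b \subset N b.
  by rewrite /M; case: eqP => // ->; rewrite subsetDl.
have solve z : z \in N a ->
    [forall S : {set A}, #|S| <= #|\bigcup_(b in S) M z b|] ->
    exists g : A -> B, injective g /\ forall a, g a \in N a.
  move=> Nz /forallP hallM; have [|g [g_inj gM]] := IHs (M z) _ hallM.
    apply: leq_trans (_ : _ <= \sum_a #|N a|) lt_s.
    rewrite (bigD1 a) // [ltnRHS](bigD1 a) //= -addSn leq_add //; last first.
      by apply: leq_sum => b _; apply/subset_leq_card.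
    by rewrite /M eqxx [ltnRHS](cardsD1 z) Nz.
  by exists g; split=> // b; apply: (subsetP (sub_M z b)).
have [/(solve x Nx) // | ] :=
  boolP [forall S : {set A}, #|S| <= #|\bigcup_(b in S) M x b|].
case/forallPn=> P; rewrite -ltnNge => ltP.
have [/(solve y Ny) // | ] :=
  boolP [forall S : {set A}, #|S| <= #|\bigcup_(b in S) M y b|].
case/forallPn=> Q; rewrite -ltnNge => ltQ.
have in_a z (S : {set A}) : #|\bigcup_(b in S) M z b| < #|S| -> a \in S.
  rewrite ltnNge; apply: contraR => aS.
  rewrite (eq_bigr N) => [|b Sb]; [exact: hallN | rewrite /M ifN //].
  by apply: contraNneq aS => <-.
have Pa := in_a _ _ ltP; have Qa := in_a _ _ ltQ.
(* UP and UQ have together at most |P| + |Q| - 2 elements. Their union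
   contains the neighbours of P :|: Q, since each of them lost a different
   element of [N a]; their intersection contains those of (P :&: Q) :\ a. *)
set UP := \bigcup_(b in P) _ in ltP; set UQ := \bigcup_(b in Q) _ in ltQ.
have leU : #|P :|: Q| <= #|UP :|: UQ|.
  apply: leq_trans (hallN _) (subset_leq_card _).
  apply/subsetP=> t /bigcupP[b PQb Nt].
  have [eq_ba | neq_ba] := eqVneq b a.
    have [eq_tx | neq_tx] := eqVneq t x.
      rewrite inE; apply/orP; right; apply/bigcupP; exists a => //.
      by rewrite /M eqxx !inE eq_tx neq_xy.
    rewrite inE; apply/orP; left; apply/bigcupP; exists a => //.
    by rewrite /M eqxx !inE neq_tx -eq_ba.
  by case/setUP: PQb => Sb; rewrite inE; apply/orP; [left | right];
    apply/bigcupP; exists b => //; rewrite /M ifN.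
have leI : #|(P :&: Q) :\ a| <= #|UP :&: UQ|.
  apply: leq_trans (hallN _) (subset_leq_card _).
  apply/subsetP=> t /bigcupP[b /setD1P[neq_ba /setIP[Pb Qb]] Nt].
  by rewrite inE; apply/andP; split; apply/bigcupP; exists b => //; rewrite /M ifN.
have := leq_add leU leI.
have := cardsUI P Q; rewrite [in X in _ + X](cardsD1 a) inE Pa Qa /=.
have := cardsUI UP UQ; move: ltP ltQ; lia.
Qed.

(** The degree only has to be constant along edges, so that all pairs of
    complementary dimensions can be treated at once.  For Hall's condition,
    let every vertex b give weight 1 / deg b to each of its edges: the edges
    leaving S weigh |S| in total because the degrees at both ends agree, and
    they weigh at most 1 at each neighbour of S. *)
Lemma symmetric_regular_matching (T : finType) (r : rel T) :
    symmetric r -> (forall a, 0 < #|[set b | r a b]|) ->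
    (forall a b, r a b -> #|[set c | r a c]| = #|[set c | r b c]|) ->
  exists g : T -> T, injective g /\ forall a, r a (g a).
Proof.
move=> r_sym deg_gt0 deg_eq; pose N a := [set b | r a b].
have [S|g [g_inj gN]] := @hall_marriage T T N; last first.
  by exists g; split=> // a; have := gN a; rewrite inE.
set NS := \bigcup_(a in S) N a.
have deg_neq0 a : (#|N a|%:R != 0 :> rat)%R.
  by rewrite pnatr_eq0 -lt0n; apply: deg_gt0.
rewrite -(ler_nat rat) -!sum1_card !natr_sum.
have -> : (\sum_(a in S) 1%:R =
    \sum_(a in S) \sum_(b in NS | r a b) #|N b|%:R^-1 :> rat)%R.
  apply: eq_bigr => a Sa; rewrite (eq_bigr (fun=> #|N a|%:R^-1)%R); last first.
    by move=> b /andP[_ /deg_eq rab]; rewrite /N rab.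
  rewrite (eq_bigl (mem (N a))) => [|b]; last first.
    rewrite !inE andb_idl // => rab.
    by apply/bigcupP; exists a; rewrite ?inE.
  by rewrite sumr_const -[RHS]mulr_natl divff.
rewrite (exchange_big_dep (mem NS)) /=; last by move=> a b _ /andP[].
apply: ler_sum => b NSb; rewrite sumr_const -[leLHS]mulr_natl.
rewrite ler_pdivrMr; last by rewrite ltr0n; apply: deg_gt0.
rewrite mul1r ler_nat; apply/subset_leq_card/subsetP => a.
by rewrite !inE => /and3P[_ _]; rewrite r_sym.
Qed.

End Matching.

(** * Greedy colourings *)

Section Greedy.

Variables (T : finType) (e : rel T) (k : nat).
Hypotheses (e_sym : symmetric e) (e_irr : irreflexive e).

Definition proper_on (S : {set T}) (c : T -> 'I_k) :=
  {in S &, forall x y, e x y -> c x != c y}.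


Lemma extend_colour (S : {set T}) c x :
    proper_on S c -> x \notin S -> #|c @: [set y in S | e x y]| < k ->
  exists2 c', proper_on (x |: S) c' & {in S, c' =1 c}.
Proof.
move=> c_ok Sx ltk; set N := [set y in S | e x y] in ltk.
have /card_gt0P[i] : 0 < #|~: (c @: N)|.
  by have := cardsC (c @: N); rewrite card_ord; move: ltk; lia.
rewrite inE => iN; exists (fun y => if y == x then i else c y) => [y z|y Sy] /=.
  have i_free t : t \in S -> e x t -> i != c t.
    by move=> St ext; apply: contraNneq iN => ->; rewrite imset_f // inE St.
  rewrite !inE; have [-> _|_ Sy] := eqVneq y x.
    by have [->|_ Sz] := eqVneq z x; [rewrite e_irr | apply: i_free].
  have [->|_ Sz] := eqVneq z x; last exact: c_ok.
  by rewrite e_sym eq_sym => _; apply: i_free.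
by case: eqP Sy => // ->; rewrite (negPf Sx).
Qed.

(** The vertices of R may be coloured in any order: the hypothesis bounds the
    number of neighbours in the whole of R :|: S, which contains everything
    that can be coloured before the turn of a vertex. *)
Lemma greedy_colouring (S R : {set T}) c :
    proper_on S c -> [disjoint R & S] ->
    {in R, forall x, #|[set y in R :|: S | e x y]| < k} ->
  exists2 c', proper_on (R :|: S) c' & {in S, c' =1 c}.
Proof.
have [s] := ubnP #|R|; elim: s => // s IHs in S R c *.
have [-> _ c_ok _ _ | [x Rx]] := set_0Vmem R; first by exists c; rewrite ?set0U.
rewrite ltnS => le_s c_ok disRS degR.
have RSE : (R :\ x) :|: (x |: S) = R :|: S by rewrite setUCA setUA setD1K.
have Sx : x \notin S by rewrite (disjointFr disRS).
have [||c1 c1_ok c1E] := extend_colour c_ok (x := x) => //.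
  apply: leq_ltn_trans (leq_imset_card _ _) (leq_ltn_trans _ (degR x Rx)).
  by apply/subset_leq_card/subsetP => y; rewrite !inE => /andP[-> ->]; rewrite orbT.
have [||||c2] := IHs (x |: S) (R :\ x) c1; rewrite ?RSE //.
- by rewrite (cardsD1 x) Rx in le_s.
- rewrite -setI_eq0; apply/eqP/setP=> y; rewrite !inE.
  by case: eqP => //= _; apply/negP => /andP[/(disjointFr disRS)->].
- by move=> y /setD1P[_ /degR].
move=> c2_ok c2E; exists c2 => // y Sy.
by rewrite c2E ?c1E // inE Sy orbT.
Qed.

(** The vertices other than u and v are coloured in three stages: those not
    adjacent to w, then the neighbours of w, then w.  In the last hypothesis
    the vertex z is a neighbour of x that comes in the second stage, while x
    comes in the first; a vertex x of degree less than k always finds a free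
    colour. *)
Lemma radius_two_brooks u v w :
    u != v -> ~~ e u v -> e w u -> e w v ->
    (forall x, #|[set y | e x y]| <= k) ->
    (forall x, x != w -> ~~ e w x -> #|[set y | e x y]| < k \/
       exists z, [/\ e x z, e w z, z != u & z != v]) ->
  exists c : T -> 'I_k, forall x y, e x y -> c x != c y.
Proof.
move=> neq_uv Nuv ewu ewv degk far.
have deg_lt (S : {set T}) x z : e x z -> z \notin S -> #|[set y in S | e x y]| < k.
  move=> exz Sz; apply: leq_trans (degk x).
  apply/proper_card/properP; split; last by exists z; rewrite !inE ?exz // (negPf Sz).
  by apply/subsetP=> y; rewrite !inE => /andP[].
have k_gt0 : 0 < k by apply: leq_ltn_trans (deg_lt set0 w u ewu _); rewrite ?inE.
pose c0 (_ : T) := Ordinal k_gt0; pose S0 := [set u; v].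
have c0_ok : proper_on S0 c0.
  have indep x y : x \in S0 -> y \in S0 -> ~~ e x y.
    by rewrite !inE => /orP[]/eqP-> /orP[]/eqP->; rewrite ?e_irr // e_sym.
  by move=> x y Sx Sy; rewrite (negPf (indep x y Sx Sy)).
pose R1 := [set x | (x != w) && ~~ e w x].
have disR1 : [disjoint R1 & S0].
  rewrite -setI_eq0; apply/eqP/setP=> x; rewrite !inE.
  apply/negP => /andP[/andP[_ Nwx] /orP[]/eqP xE];
  by rewrite xE ?ewu ?ewv in Nwx.
have [|c1 c1_ok c1E] := greedy_colouring c0_ok disR1.
  move=> x; rewrite inE => /andP[xw Nwx].
  have [ltk | [z [exz ewz zu zv]]] := far x xw Nwx.
    apply: leq_ltn_trans ltk; apply/subset_leq_card/subsetP => y.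
    by rewrite !inE => /andP[].
  by apply: deg_lt exz _; rewrite !inE ewz (negPf zu) (negPf zv) andbF.
have neq_e x : e w x -> x != w.
  by move=> ewx; apply: contraTneq ewx => ->; rewrite e_irr.
pose R2 := [set x | e w x] :\: S0.
have disR2 : [disjoint R2 & R1 :|: S0].
  rewrite -setI_eq0; apply/eqP/setP=> x; rewrite !inE.
  by case: (e w x) => //=; rewrite ?andbF //=; case: (x == u); case: (x == v).
have wR2 : w \notin R2 :|: (R1 :|: S0).
  rewrite !inE e_irr eqxx /= andbF /=.
  by rewrite eq_sym (negPf (neq_e u ewu)) eq_sym (negPf (neq_e v ewv)).
have [|c2 c2_ok c2E] := greedy_colouring c1_ok disR2.
  move=> x; rewrite !inE => /andP[_ ewx]; apply: deg_lt wR2.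
  by rewrite e_sym.
set S2 := R2 :|: _ in wR2 c2_ok.
have inS2 x : x \in S0 -> x \in S2 by move=> Sx; do 2!(apply/setUP; right).
have S0u : u \in S0 by rewrite !inE eqxx.
have S0v : v \in S0 by rewrite !inE eqxx orbT.
have c2uv : c2 u = c2 v.
  by rewrite !c2E ?c1E //; apply/setUP; right.
have [|c3 c3_ok _] := extend_colour c2_ok wR2.
  (* The vertex u adds no colour to those around w, since v has the same. *)
  have -> : c2 @: [set y in S2 | e w y] = c2 @: [set y in S2 :\ u | e w y].
    apply/eqP; rewrite eqEsubset andbC imsetS /=; last first.
      by apply/subsetP=> y; rewrite !inE => /andP[/andP[_ ->] ->].
    apply/subsetP=> _ /imsetP[y + ->]; rewrite inE => /andP[S2y ewy].
    have [->|yu] := eqVneq y u; last first.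
      by apply: imset_f; rewrite inE ewy andbT; apply/setD1P.
    rewrite c2uv; apply: imset_f; rewrite inE ewv andbT.
    by apply/setD1P; rewrite eq_sym neq_uv inS2.
  apply: leq_ltn_trans (leq_imset_card _ _) _.
  by apply: deg_lt ewu _; rewrite !inE eqxx.
have all_in x : x \in w |: S2.
  by rewrite !inE; case: (x == w); case: (e w x); case: (x == u); case: (x == v).
by exists c3 => x y; apply: c3_ok.
Qed.

End Greedy.

Section ChromaticBounds.

Variables (T : finType) (e : rel T) (e_irr : irreflexive e).

Lemma clique_le_chromatic_number (K : {set T}) :
  {in K &, forall x y, x != y -> e x y} -> #|K| <= chromatic_number e_irr.
Proof.
move=> cliqueK; rewrite /chromatic_number.
case: ex_minnP => k /existsP[f /andP[/forallP f_ok /eqP <-]] _.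
rewrite -(@card_in_imset _ _ f) => [|x y Kx Ky fxy].
  by apply/subset_leq_card/subsetP=> _ /imsetP[x _ ->]; apply: imset_f.
apply: contra_eq fxy => /(cliqueK x y Kx Ky).
by move/implyP: (forallP (f_ok x) y).
Qed.

Lemma chromatic_number_le_card (C : finType) (f : T -> C) (D : {set C}) :
  proper_coloring e f -> (forall x, f x \in D) -> chromatic_number e_irr <= #|D|.
Proof.
move=> f_ok fD; apply: leq_trans (chromatic_number_le e_irr f_ok) _.
rewrite cardE; apply: uniq_leq_size (undup_uniq _) _ => c.
by rewrite mem_undup mem_enum => /codomP[x ->].
Qed.

End ChromaticBounds.

(** * Counting subspaces *)

(** Subspaces are those of [V], while counting vectors requires the finite
    alias [finvect_type V].  The two vector space structures become
    convertible only once [V] is a constructor. *)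
Lemma card_mem_vspace (F : finFieldType) (V : vectType F) (U : {vspace V}) :
  #|[set x : finvect_type V | (x : V) \in U]| = (#|F| ^ \dim U)%N.
Proof.
case: V U => T c U.
rewrite cardsE -(@card_vspace F (finvect_type (Vector.Pack c)) c U).
by apply: eq_card => x.
Qed.

Section CountingSubspaces.

Local Open Scope ring_scope.

Variables (F : finFieldType) (V : vectType F).
Local Notation fV := (finvect_type V).
Local Notation q := #|F|.
Implicit Types (A U W : {vspace V}).

(** The equation on dimensions says that X is linearly independent modulo A. *)
Definition indep_tuples A U t : {set t.-tuple fV} :=
  [set X : t.-tuple fV |
    (<<X : seq V>> <= U)%VS & \dim (A + <<X : seq V>>) == (\dim A + t)%N].

Lemma dimv_add_line A (x : V) : \dim (A + <[x]>) = (\dim A + (x \notin A))%N.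
Proof.
have [Ax | NAx] := boolP (x \in A); first by rewrite (addv_idPl _) ?addn0.
rewrite dimv_disjoint_sum ?dim_vline.
  by case: eqP NAx => // ->; rewrite mem0v.
apply/eqP; rewrite -subv0; apply/subvP=> y.
rewrite memv_cap => /andP[Ay /vlineP[a yE]].
rewrite memv0 yE; have [-> | a0] := eqVneq a 0; first by rewrite scale0r.
by case/negP: NAx; move: Ay; rewrite yE rpredZeq (negPf a0).
Qed.

Lemma indep_tuple_cons A U t (x : V) (X : t.-tuple fV) :
  ([tuple of (x : fV) :: X] \in indep_tuples A U t.+1) =
  [&& x \in U, x \notin A & X \in indep_tuples (A + <[x]>) U t].
Proof.
rewrite !inE /= span_cons subv_add -memvE -andbA; congr (_ && _).
rewrite andbCA; congr (_ && _); rewrite addvA dimv_add_line.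
have [Ax | NAx] /= := boolP (x \in A); last by rewrite -addnA add1n.
rewrite (addv_idPl Ax) // ?addn0; apply/negbTE.
have := leq_trans (dimv_add_leqif A <<X : seq V>>)
  (leq_add (leqnn _) (dim_span (X : seq V))).
rewrite size_tuple; lia.
Qed.

(** The first vector can be any element of U outside A, and the others form a
    tuple that is independent modulo A and this vector. *)
Lemma card_indep_tuples A U t : (A <= U)%VS ->
  #|indep_tuples A U t| = (\prod_(i < t) (q ^ \dim U - q ^ (\dim A + i)))%N.
Proof.
elim: t A => [|t IHt] A sAU.
  rewrite big_ord0; apply/eqP/cards1P; exists [tuple]; apply/setP=> X.
  by rewrite [X]tuple0 !inE /= span_nil sub0v addv0 addn0 !eqxx.
pose consX (p : fV * t.-tuple fV) := [tuple of p.1 :: p.2].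
rewrite -sum1_card (reindex consX) /=; last first.
  exists (fun X : t.+1.-tuple fV => (thead X, [tuple of behead X])).
  - move=> [x X] _; congr (_, _); exact: val_inj.
  by move=> X _; rewrite /consX /= -tuple_eta.
rewrite -(pair_big_dep xpredT
  (fun x X => consX (x, X) \in indep_tuples A U t.+1) (fun _ _ => 1%N)) /=.
rewrite (bigID (fun x : fV => ((x : V) \in U) && ((x : V) \notin A))) /=.
rewrite addnC big1 => [|x NUA]; last first.
  by apply: big_pred0 => X; rewrite (indep_tuple_cons A U x) andbA (negPf NUA).
rewrite (eq_bigr (fun=> \prod_(i < t)
  (q ^ \dim U - q ^ ((\dim A).+1 + i)))%N) => [|x /andP[Ux NAx]].
  rewrite sum_nat_const big_ord_recl addn0 add0n; congr (_ * _)%N; last first.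
    by apply: eq_bigr => i _; rewrite addSnnS.
  rewrite -!card_mem_vspace -cardsDS; last first.
    by apply/subsetP=> x; rewrite !inE; apply/subvP.
  by apply: eq_card => x; rewrite !inE andbC.
have <- : \dim (A + <[x : V]>) = (\dim A).+1 by rewrite dimv_add_line NAx addn1.
rewrite -IHt; last by rewrite subv_add sAU -memvE.
rewrite -sum1_card; apply: eq_bigl => X.
by rewrite (indep_tuple_cons A U x) Ux NAx.
Qed.

(** A t-tuple independent modulo A spans a t-dimensional subspace that meets A
    in 0, and each such subspace is spanned by the same number of tuples,
    those independent modulo 0 inside it.  The truncated subtractions are
    harmless: when t > dim U - dim A, the factor for i = dim U - dim A makes
    the right-hand side zero, as it should be. *)
Lemma card_disjoint_subspaces A U t : (A <= U)%VS ->
  (#|[set W : {vspace V} | [&& W <= U, \dim W == t & (W :&: A == 0)]%VS]|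
    * \prod_(i < t) (q ^ t - q ^ i)
   = \prod_(i < t) (q ^ \dim U - q ^ (\dim A + i)))%N.
Proof.
move=> sAU; rewrite -(card_indep_tuples t sAU) -[RHS]sum1_card.
set D := [set W | _].
rewrite (partition_big (fun X : t.-tuple fV => <<X : seq V>>%VS) (mem D)) /=.
  rewrite -sum_nat_const; apply: eq_bigr => W.
  rewrite inE => /and3P[sWU /eqP dimW /eqP WA0].
  have -> : (\prod_(i < t) (q ^ t - q ^ i))%N = #|indep_tuples 0%VS W t|.
    by rewrite card_indep_tuples ?sub0v // dimv0 dimW.
  rewrite -sum1_card; apply: eq_bigl => X; rewrite !inE add0v dimv0.
  rewrite [_ == W]eqEdim dimW add0n.
  have [sXW | _] := boolP (_ <= W)%VS; last by rewrite andbF.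
  rewrite (subv_trans sXW sWU) /=.
  have XA0 : (A :&: <<X : seq V>> = 0)%VS.
    by apply/eqP; rewrite -subv0 -WA0 [(A :&: _)%VS]capvC capvS.
  have le_t : (\dim <<X : seq V>> <= t)%N.
    by rewrite (leq_trans (dim_span (X : seq V))) ?size_tuple.
  by rewrite dimv_disjoint_sum // eqn_add2l eqn_leq le_t /= andbb.
move=> X; rewrite !inE => /andP[-> /eqP dimAX] /=.
have le_t : (\dim <<X : seq V>> <= t)%N.
  by rewrite (leq_trans (dim_span (X : seq V))) ?size_tuple.
have := dimv_sum_cap A <<X : seq V>>; rewrite dimAX capvC -dimv_eq0; lia.
Qed.

Lemma prod_qdiff_neq0 t : \prod_(i < t) ((q ^ t - q ^ i)%N%:R : rat) != 0.
Proof.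
apply/prodf_neq0 => i _; rewrite pnatr_eq0 subn_eq0 -ltnNge ltn_exp2l //.
exact: finNzRing_gt1.
Qed.

Lemma natr_qdiff m i : (i <= m)%N ->
  (q ^ m - q ^ i)%N%:R = q%:R ^+ i * (q%:R ^+ (m - i) - 1) :> rat.
Proof.
move=> le_im; have q_gt0 : (0 < q)%N by apply: ltnW; apply: finNzRing_gt1.
by rewrite natrB ?leq_pexp2l // mulrBr -exprD subnKC // mulr1 !natrX.
Qed.

Lemma card_subspaces U t :
  #|[set W : {vspace V} | (W <= U)%VS & \dim W == t]|%:R = gauss_binom q (\dim U) t.
Proof.
rewrite /gauss_binom; case: leqP => [le_t | lt_t]; last first.
  rewrite (_ : [set W | _] = set0) ?cards0 //; apply/setP=> W; rewrite !inE.
  by apply/negP => /andP[/dimvS + /eqP dimW]; rewrite dimW leqNgt lt_t.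
have := card_disjoint_subspaces t (sub0v U).
move/(congr1 (fun k => k%:R : rat)); rewrite natrM !natr_prod dimv0.
move/(canRL (mulfK (prod_qdiff_neq0 t))).
rewrite (_ : [set W | _] = [set W : {vspace V} | (W <= U)%VS & \dim W == t]); last first.
  by apply/setP=> W; rewrite !inE capv0 eqxx andbT.
move=> ->; rewrite -prodf_div; apply: eq_bigr => i _.
have q_neq0 : q%:R ^+ i != 0 :> rat.
  by rewrite expf_neq0 // pnatr_eq0 -lt0n; apply: ltnW; apply: finNzRing_gt1.
rewrite add0n !natr_qdiff ?(ltnW (ltn_ord i)) //; last first.
  exact: leq_trans (ltnW (ltn_ord i)) le_t.
by rewrite -mulf_div divff // mul1r.
Qed.

Definition complementary U W := (\dim U + \dim W == \dim {:V})%N && (U :&: W == 0)%VS.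

Lemma complementary_sym : symmetric complementary.
Proof. by move=> U W; rewrite /complementary addnC capvC. Qed.

(** Here t = dim V - dim U, and every factor of the numerator is q^(dim U)
    times the corresponding factor of the denominator. *)
Lemma card_complements U :
  #|[set W | complementary U W]| = (q ^ (\dim U * (\dim {:V} - \dim U)))%N.
Proof.
set t := (_ - \dim U)%N; have le_U : (\dim U <= \dim {:V})%N := dimvS (subvf U).
have := card_disjoint_subspaces t (subvf U).
rewrite (_ : [set W | _] = [set W | complementary U W]); last first.
  apply/setP=> W; rewrite !inE subvf /complementary capvC /=; congr (_ && _).
  by rewrite /t; apply/eqP/eqP; lia.
have -> : \dim {:V} = (\dim U + t)%N by rewrite subnKC.
under [RHS]eq_bigr do rewrite !expnD -mulnBr.
rewrite big_split /= prod_nat_const card_ord -expnM => /eqP.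
rewrite eqn_pmul2r => [/eqP //|].
by rewrite lt0n -(pnatr_eq0 rat) natr_prod; apply: prod_qdiff_neq0.
Qed.

Lemma exists_superspace A t : (\dim A <= t <= \dim {:V})%N ->
  exists2 W, (A <= W)%VS & \dim W = t.
Proof.
case/andP=> leAt le_tV; pose X := take (t - \dim A) (vbasis A^C).
exists (A + <<X>>)%VS; first exact: addvSl.
have X_free : free X.
  apply: (@catl_free _ _ (drop (t - \dim A) (vbasis A^C))).
  by rewrite cat_take_drop (basis_free (vbasisP _)).
have sX : (<<X>> <= A^C)%VS.
  rewrite -[in X in (_ <= X)%VS](span_basis (vbasisP A^C)).
  by apply: sub_span => x /mem_take.
have AX0 : (A :&: <<X>> = 0)%VS.
  by apply/eqP; rewrite -subv0 -(capv_compl A) capvS.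
rewrite dimv_disjoint_sum // (eqnP X_free) size_take size_tuple dimv_compl.
case: ifP; lia.
Qed.

End CountingSubspaces.

Section GaussianBinomial.

Local Open Scope ring_scope.

(** With f s the product of the q^i - 1 for 0 < i <= s, the Gaussian binomial is
    f m / (f t * f (m - t)). *)
Lemma gauss_binom_sym q m t : (1 < q)%N -> (t <= m)%N ->
  gauss_binom q m t = gauss_binom q m (m - t).
Proof.
move=> q_gt1; pose f m : rat := \prod_(i < m) (q%:R ^+ i.+1 - 1).
have f_neq0 s : f s != 0.
  apply/prodf_neq0 => i _; rewrite subr_eq0 -natrX -[1]/(1%:R) eqr_nat.
  by rewrite -(expn0 q) eqn_exp2l.
have prodE s : f s = \prod_(i < s) (q%:R ^+ (s - i) - 1).
  rewrite /f (reindex_inj rev_ord_inj) /=; apply: eq_bigr => i _.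
  by rewrite subnSK.
suff gaussE s : (s <= m)%N -> gauss_binom q m s = f m / (f s * f (m - s)%N).
  by move=> le_tm; rewrite !gaussE ?leq_subr // subKn // [f t * _]mulrC.
move=> le_sm; rewrite /gauss_binom le_sm prodf_div -prodE invfM mulrA mulrAC.
congr (_ / _); apply: (mulIf (f_neq0 (m - s)%N)); rewrite divfK // !prodE.
rewrite -[in RHS](subnKC le_sm) big_split_ord /=; congr (_ * _).
  by apply: eq_bigr => i _; rewrite subnKC.
by apply: eq_bigr => i _; rewrite subnDA addKn.
Qed.

End GaussianBinomial.

(** * The intersection graph of subspaces *)

Section SubspaceGraphBounds.

Variables (F : finFieldType) (V : vectType F).
Local Notation q := #|F|.
Implicit Types (U W X : {vspace V}).

Lemma capv_neq0_dim H U W : (U <= H)%VS -> (W <= H)%VS ->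
  \dim H < \dim U + \dim W -> (U :&: W)%VS != 0%VS.
Proof.
move=> sUH sWH; rewrite -dimv_eq0 -dimv_sum_cap.
have : \dim (U + W) <= \dim H by apply: dimvS; rewrite subv_add sUH.
lia.
Qed.

Lemma card_dim_range a b :
  #|[set W : {vspace V} | a <= \dim W < b]| =
  \sum_(a <= i < b) #|[set W : {vspace V} | \dim W == i]|.
Proof.
elim: b => [|b IHb].
  rewrite big_geq // (_ : [set W | _] = set0) ?cards0 //.
  by apply/setP=> W; rewrite !inE andbF.
have [le_ab | lt_ba] := leqP a b; last first.
  rewrite big_geq // (_ : [set W | _] = set0) ?cards0 //.
  by apply/setP=> W; rewrite !inE; lia.
rewrite big_nat_recr //= -IHb -[LHS](cardsID [set W : {vspace V} | \dim W < b]).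
by congr (_ + _); apply: eq_card => W; rewrite !inE; lia.
Qed.

Lemma complement_bijection :
  exists g : {vspace V} -> {vspace V}, injective g /\ forall W, complementary W (g W).
Proof.
have q_gt0 : 0 < q by apply: ltnW; apply: finNzRing_gt1.
apply: symmetric_regular_matching; first exact: complementary_sym.
  by move=> W; rewrite card_complements expn_gt0 q_gt0.
move=> U W /andP[/eqP dimUW _]; rewrite !card_complements -dimUW addKn addnK.
by rewrite mulnC.
Qed.

Lemma card_dim i :
  (#|[set W : {vspace V} | \dim W == i]|%:R = gauss_binom q (\dim {:V}) i :> rat)%R.
Proof.
rewrite -card_subspaces; congr (_%:R)%R.
by apply: eq_card => W; rewrite !inE subvf.
Qed.

Lemma sum_gauss_binom_card m :
  (\sum_(1 <= i < m) gauss_binom q (\dim {:V}) i =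
   #|[set W : {vspace V} | (0 < \dim W < m)%N]|%:R :> rat)%R.
Proof.
rewrite card_dim_range natr_sum; by apply: eq_bigr => i _; rewrite card_dim.
Qed.

Lemma chi_subspace_graph_ge m : \dim {:V} = m.*2 -> 0 < m ->
  (\sum_(1 <= i < m) gauss_binom q m.*2 i + gauss_binom q m.*2.-1 m.-1
    <= (chi_subspace_graph V)%:R :> rat)%R.
Proof.
move=> dimV m_gt0; have [|H _ dimH] := @exists_superspace _ V 0%VS m.*2.-1.
  by rewrite dimv0 dimV leq_pred.
have [g [g_inj gP]] := complement_bijection.
(* The clique is A :|: B. Choosing complements injects the subspaces of
   dimension between 1 and m - 1 into A. *)
pose A := [set W : {vspace V} | m < \dim W < m.*2].
pose B := [set W : {vspace V} | (W <= H)%VS & \dim W == m].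
have leA : #|[set W : {vspace V} | 0 < \dim W < m]| <= #|A|.
  rewrite -(card_imset _ g_inj); apply/subset_leq_card/subsetP=> _ /imsetP[W + ->].
  by rewrite !inE; have /andP[/eqP + _] := gP W; rewrite dimV; lia.
(* B counts m-dimensional subspaces of a space of dimension 2m - 1, so this
   is the symmetry of the Gaussian binomials. *)
have -> : gauss_binom q m.*2.-1 m.-1 = #|B|%:R%R.
  rewrite card_subspaces dimH [RHS]gauss_binom_sym ?finNzRing_gt1 //; last lia.
  by congr gauss_binom; lia.
rewrite -[in X in (X + _)%R]dimV sum_gauss_binom_card -natrD ler_nat.
have disAB : A :&: B = set0.
  by apply/setP=> W; rewrite !inE; lia.
apply: leq_trans (leq_add leA (leqnn _)) _; rewrite -cardsUI disAB cards0 addn0.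
pose K := [set x : subspace_vertex V | val x \in A :|: B].
have -> : A :|: B = val @: K.
  apply/setP=> W; apply/idP/imsetP=> [ABW | [x + ->]]; last by rewrite in_set.
  have vertW : (W != 0%VS) && (W != fullv).
    by move: ABW; rewrite !inE -dimv_eq0 eqEdim subvf dimV /=; lia.
  by exists (Sub W vertW : subspace_vertex V); rewrite ?SubK // in_set SubK.
rewrite card_imset; last exact: val_inj.
apply: clique_le_chromatic_number => x y; rewrite !in_set => Kx Ky neq_xy.
rewrite /subspace_adj neq_xy /=.
have [/andP[sx sy] | ] := boolP ((val x <= H) && (val y <= H))%VS.
  apply: (capv_neq0_dim sx sy); rewrite dimH; lia.
rewrite negb_and => NH; apply: (capv_neq0_dim (subvf _) (subvf _)); rewrite dimV.
by case/orP: NH => /negPf NH; rewrite NH ?andbF ?orbF /= in Kx Ky; lia.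
Qed.

Section Middle.

Variable m : nat.
Hypotheses (dimV : \dim {:V} = m.*2) (m_gt1 : 1 < m).

(** The subgraph on the m-dimensional subspaces, with all other subspaces
    added as isolated points in order to avoid a subtype. *)
Definition middle_adj : rel {vspace V} := fun U W =>
  [&& \dim U == m, \dim W == m, U != W & (U :&: W)%VS != 0%VS].

Lemma middle_adj_sym : symmetric middle_adj.
Proof. by move=> U W; rewrite /middle_adj [U == W]eq_sym capvC andbCA. Qed.

Lemma middle_adj_irr : irreflexive middle_adj.
Proof. by move=> U; rewrite /middle_adj eqxx !andbF. Qed.

(** An m-dimensional subspace is adjacent to U, complementary to U, or U. *)
Lemma card_middle_adj U : \dim U = m ->
  #|[set W | middle_adj U W]| + (q ^ (m * m)).+1 =
  #|[set W : {vspace V} | \dim W == m]|.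
Proof.
move=> dimU; have := card_complements U; rewrite dimU dimV -addnn addnK => <-.
have mU : U \in [set W : {vspace V} | \dim W == m] by rewrite inE dimU.
rewrite (cardsD1 U [set W | \dim W == m]) mU addnS add1n; congr _.+1.
rewrite -[RHS](cardsID [set W : {vspace V} | (U :&: W)%VS != 0%VS]).
congr (_ + _); apply: eq_card => W; rewrite !inE /middle_adj /complementary dimU.
  by rewrite eqxx [U == W]eq_sym /= andbA [(_ == m) && _]andbC.
rewrite negbK dimV -addnn eqn_add2l andbC; have [-> | _] //= := eqVneq W U.
by rewrite capvv -dimv_eq0 dimU; case: (m) m_gt1.
Qed.

(** Take u and v complementary, and w through a nonzero vector of u and one
    of v.  If a subspace U meets w in 0, then any W through a nonzero
    vector of U and a nonzero vector x1 of w is adjacent to both, and W differs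
    from u and v if x1 lies in neither of them.  Such an x1 exists because w is
    not the union of two proper subspaces. *)
Lemma middle_colouring :
  exists c : {vspace V} ->
      'I_(#|[set W : {vspace V} | \dim W == m]| - (q ^ (m * m)).+1),
    forall U W, middle_adj U W -> c U != c W.
Proof.
set k := _ - _.
have degm U : \dim U = m -> #|[set W | middle_adj U W]| = k.
  by move=> dimU; rewrite /k -(card_middle_adj dimU) addnK.
have deg0 U : \dim U != m -> #|[set W | middle_adj U W]| = 0.
  by move=> dimU; apply: eq_card0 => W; rewrite inE /middle_adj (negPf dimU).
have super2 (x y : V) : exists2 W : {vspace V}, (x \in W) && (y \in W) & \dim W = m.
  have [|W] := @exists_superspace _ V (<[x]> + <[y]>)%VS m.
    rewrite dimV -addnn leq_addr andbT (leq_trans (dimv_add_leqif _ _)) //.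
    by rewrite !dim_vline; apply: leq_trans m_gt1; case: eqP; case: eqP.
  by rewrite subv_add -!memvE => sxyW dimW; exists W.
have pick_neq0 W : \dim W = m -> vpick W != 0%R.
  by rewrite vpick0 -dimv_eq0 => ->; lia.
have cap_neq0 (x : V) U W : x != 0%R -> x \in U -> x \in W -> (U :&: W)%VS != 0%VS.
  move=> x0 Ux Wx; apply: contraNneq x0 => UW0.
  by rewrite -memv0 -UW0 memv_cap Ux.
have not_mem (x : V) U W : x != 0%R -> x \in U -> (U :&: W = 0)%VS -> x \notin W.
  by move=> x0 Ux; apply: contra_eqN => Wx; apply: cap_neq0 Wx.
have [|u _ dimu] := @exists_superspace _ V 0%VS m.
  by rewrite dimv0 dimV -addnn leq_addr.
have dimuC : \dim u^C = m by rewrite dimv_compl dimV dimu -addnn addnK.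
have [w /andP[wu wv] dimw] := super2 (vpick u) (vpick u^C).
have u0 := pick_neq0 _ dimu; have v0 := pick_neq0 _ dimuC.
have Nvu : vpick u^C \notin u.
  by apply: (not_mem _ u^C%VS) => //; rewrite ?memv_pick // capvC capv_compl.
have Nuv : vpick u \notin u^C%VS.
  by apply: (not_mem _ u) => //; rewrite ?memv_pick // capv_compl.
have wNu : w != u by apply: contraNneq Nvu => wE; rewrite -{2}wE.
have wNv : w != u^C%VS by apply: contraNneq Nuv => wE; rewrite -wE.
have Nsub U : \dim U = m -> w != U -> exists2 x, x \in w & x \notin U.
  move=> dimU neq_wU; have /subvPn// : ~~ (w <= U)%VS.
  by apply: contra neq_wU => swU; rewrite eqEdim swU dimU dimw leqnn.
have [x1 wx1 [Nux1 Nvx1]] : exists2 x, x \in w & x \notin u /\ x \notin u^C%VS.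
  have [a wa Nua] := Nsub u dimu wNu; have [b wb Nvb] := Nsub _ dimuC wNv.
  have [va | Nva] := boolP (a \in u^C%VS); last by exists a.
  have [ub | Nub] := boolP (b \in u); last by exists b.
  exists (a + b)%R; first exact: memvD.
  by rewrite rpredDr // rpredDl.
have x10 : x1 != 0%R by apply: contraNneq Nux1 => ->; rewrite mem0v.
apply: (radius_two_brooks middle_adj_sym middle_adj_irr (u := u) (v := u^C%VS) (w := w)).
- by apply: contraNneq Nvu => uE; rewrite {2}uE memv_pick.
- by rewrite /middle_adj capv_compl eqxx !andbF.
- by rewrite /middle_adj dimu dimw eqxx wNu /=; apply: cap_neq0 u0 wu (memv_pick u).
- by rewrite /middle_adj dimuC dimw eqxx wNv /=; apply: cap_neq0 v0 wv (memv_pick _).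
- move=> U; have [/degm-> // | /deg0-> //] := eqVneq (\dim U) m.
move=> U neq_Uw; have [dimU | /deg0 degU _] := eqVneq (\dim U) m; last first.
  (* The isolated points have degree 0, which is less than k. *)
  left; rewrite degU -(degm u dimu); apply/card_gt0P; exists w.
  rewrite inE /middle_adj dimu dimw eqxx eq_sym wNu /=.
  by apply: cap_neq0 u0 (memv_pick u) wu.
rewrite /middle_adj dimU dimw eqxx eq_sym neq_Uw negbK /= => /eqP wU0; right.
have [W /andP[UW wW] dimW] := super2 (vpick U) x1.
have U0 := pick_neq0 _ dimU; have NUx1 := not_mem _ _ _ x10 wx1 wU0.
have NwU : vpick U \notin w.
  by apply: (not_mem _ U) => //; [apply: memv_pick | rewrite capvC].
exists W; rewrite dimW eqxx /=; split.
- by rewrite (cap_neq0 _ _ _ U0 (memv_pick U) UW) andbT; apply: contraNneq NUx1 => ->.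
- by rewrite (cap_neq0 _ _ _ x10 wx1 wW) andbT; apply: contraNneq NwU => ->.
- by apply: contraNneq Nux1 => <-.
by apply: contraNneq Nvx1 => <-.
Qed.

Lemma chi_subspace_graph_le :
  ((chi_subspace_graph V)%:R <= \sum_(1 <= i < m) gauss_binom q m.*2 i
     + gauss_binom q m.*2 m - q%:R ^+ (m * m) - 1 :> rat)%R.
Proof.
have [c cP] := middle_colouring; set k := _ - _ in c cP.
have [g [g_inj gP]] := complement_bijection.
(* Distinct vertices of dimension other than m share a colour only if one is
   the partner of the other, and then they meet in 0. *)
pose f (x : subspace_vertex V) : {vspace V} + 'I_k :=
  let W := val x in
  if \dim W == m then inr (c W) else if \dim W < m then inl W else inl (g W).
pose small := [set W : {vspace V} | 0 < \dim W < m].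
have leD : chi_subspace_graph V <= #|small| + k.
  pose D : {set {vspace V} + 'I_k} := inl @: small :|: inr @: setT.
  apply: (@leq_trans #|D|); last first.
    rewrite (leq_trans (leq_card_setU _ _)) // leq_add ?leq_imset_card //.
    by rewrite (leq_trans (leq_imset_card _ _)) // cardsT card_ord.
  apply: (@chromatic_number_le_card _ _ _ _ f) => [|x]; last first.
    have /andP[x0 xV] : (\dim (val x) != 0) && ~~ (m.*2 <= \dim (val x)).
      by have := valP x; rewrite /= -dimv_eq0 eqEdim subvf dimV.
    have := gP (val x); rewrite /complementary dimV => /andP[/eqP dimg _].
    apply/setUP; rewrite /f; case: ifP => xm; first by right; apply: imset_f.
    by left; case: ifP => xs; apply: imset_f; rewrite inE; lia.
  apply/forallP=> x; apply/forallP=> y; apply/implyP=> /andP[neq_xy xy0].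
  have disj W : (W :&: g W = 0)%VS by have /andP[_ /eqP] := gP W.
  rewrite /f; case: ifP => xm; case: ifP => ym; do ?case: ifP => // ?.
  - rewrite (inj_eq inr_inj); apply: cP.
    by rewrite /middle_adj xm ym xy0 (inj_eq val_inj) neq_xy.
  - by apply: contraNneq xy0 => -[xy]; rewrite (xy : val x = g (val y)) capvC disj.
  - by apply: contraNneq xy0 => -[xy]; rewrite -(xy : g (val x) = val y) disj.
  - by apply: contraNneq neq_xy => -[/g_inj xy]; apply/eqP/val_inj.
have [|u _ dimu] := @exists_superspace _ V 0%VS m.
  by rewrite dimv0 dimV -addnn leq_addr.
have le_k : (q ^ (m * m)).+1 <= #|[set W : {vspace V} | \dim W == m]|.
  by rewrite -(card_middle_adj dimu) leq_addl.
apply: le_trans (_ : (#|small| + k)%:R <= _)%R; first by rewrite ler_nat.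
rewrite natrD -dimV sum_gauss_binom_card -!addrA lerD2l -card_dim natrB //.
by rewrite -addn1 natrD natrX opprD.
Qed.

End Middle.

End SubspaceGraphBounds.

Theorem corollary10 (F : finFieldType) (V : vectType F) (q n : nat)
    (hq : #|F| = q) (hn : \dim (fullv : {vspace V}) = n)
    (n_gt0 : 0 < n) (n_even : ~~ odd n) :
  ((\sum_(1 <= i < n./2) gauss_binom q n i
      + gauss_binom q (n - 1) ((n - 2) %/ 2)
    <= (chi_subspace_graph V)%:R)
   /\
   ((2 < n)%N ->
    (chi_subspace_graph V)%:R
    <= \sum_(1 <= i < n./2) gauss_binom q n i
         + gauss_binom q n n./2 - q%:R ^+ (n ^ 2 %/ 4) - 1))%R.
Proof.
have nE : n = n./2.*2 by rewrite even_halfK.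
rewrite -hq; set m := n./2 in nE *; rewrite nE in hn n_gt0 *.
have -> : (m.*2 - 1 = m.*2.-1)%N by rewrite subn1.
have -> : ((m.*2 - 2) %/ 2 = m.-1)%N by lia.
have -> : (m.*2 ^ 2 %/ 4 = m * m)%N by rewrite -muln2 expnMn mulnK // mulnn.
split=> [|n_gt2]; first by apply: chi_subspace_graph_ge => //; lia.
by apply: chi_subspace_graph_le => //; lia.
Qed.
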